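(* Let $\mathbf{k}$ be a commutative ring with identity and let $\mathfrak g=(\mathfrak g,[\,,\,]_{\mathfrak g},\beta_{\mathfrak g})$ be an involutive Hom-Lie algebra over $\mathbf{k}$. Let $T^+_h(\mathfrak g)=(T^+_h(\mathfrak g),\odot,\alpha_T)$ be the Hom-tensor algebra (the free involutive Hom-associative algebra) on the Hom-module $(\mathfrak g,\beta_{\mathfrak g})$ constructed in the context. Let $I_{\mathfrak g,\beta}$ be the Hom-ideal of $T^+_h(\mathfrak g)$ generated by the set $$\{x\otimes y-y\otimes x-[x,y]_{\mathfrak g}\mid x,y\in\mathfrak g\},$$ and let $\mathfrak U_h(\mathfrak g):=T^+_h(\mathfrak g)/I_{\mathfrak g,\beta}$ be the quotient Hom-associative algebra. Let $\phi_0:=\pi\circ i_{\mathfrak g}:\mathfrak g\to\mathfrak U_h(\mathfrak g)$, $x\mapsto x+I_{\mathfrak g,\beta}$, be the composition of the natural inclusion $i_{\mathfrak g}:\mathfrak g\to T^+_h(\mathfrak g)$ with the quotient map $\pi:T^+_h(\mathfrak g)\to\mathfrak U_h(\mathfrak g)$. Then $(\mathfrak U_h(\mathfrak g),\phi_0)$ is a universal enveloping Hom-associative algebra of $\mathfrak g$. The universal enveloping Hom-associative algebra of $\mathfrak g$ is unique up to isomorphism.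
   Context: All modules, linear maps and tensor products are over $\mathbf{k}$. A Hom-associative algebra is a triple $(A,\cdot,\alpha_A)$ with $A$ a $\mathbf{k}$-module, $\cdot:A\otimes A\to A$ linear, and $\alpha_A:A\to A$ linear, such that $\alpha_A(x\cdot y)=\alpha_A(x)\cdot\alpha_A(y)$ and $\alpha_A(x)\cdot(y\cdot z)=(x\cdot y)\cdot\alpha_A(z)$ for all $x,y,z\in A$ (no unit is required). It is involutive if $\alpha_A^2=\mathrm{id}$. Morphisms of Hom-associative algebras are linear maps commuting with the multiplications and with the operators $\alpha$. A Hom-ideal of $A$ is a submodule $I\subseteq A$ with $x\cdot y\in I$, $y\cdot x\in I$ for all $x\in I$, $y\in A$, and $\alpha_A(I)\subseteq I$; the Hom-ideal generated by a set is the smallest Hom-ideal containing it. A Hom-Lie algebra is a triple $(\mathfrak g,[\,,\,]_{\mathfrak g},\beta_{\mathfrak g})$ with $\mathfrak g$ a $\mathbf{k}$-module, $[\,,\,]_{\mathfrak g}:\mathfrak g\times\mathfrak g\to\mathfrak g$ bilinear and $\beta_{\mathfrak g}:\mathfrak g\to\mathfrak g$ linear such that for all $x,y,z\in\mathfrak g$: $[x,y]_{\mathfrak g}=-[y,x]_{\mathfrak g}$; $[\beta_{\mathfrak g}(x),[y,z]_{\mathfrak g}]_{\mathfrak g}+[\beta_{\mathfrak g}(y),[z,x]_{\mathfrak g}]_{\mathfrak g}+[\beta_{\mathfrak g}(z),[x,y]_{\mathfrak g}]_{\mathfrak g}=0$; and $\beta_{\mathfrak g}([x,y]_{\mathfrak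 g})=[\beta_{\mathfrak g}(x),\beta_{\mathfrak g}(y)]_{\mathfrak g}$. It is involutive if $\beta_{\mathfrak g}^2=\mathrm{id}$. A morphism of Hom-Lie algebras is a linear map commuting with the brackets and with the operators $\beta$. Every Hom-associative algebra $(A,\cdot,\alpha_A)$ gives a Hom-Lie algebra $(A,[\,,\,]_A,\beta_A)$ with $[x,y]_A=x\cdot y-y\cdot x$ and $\beta_A=\alpha_A$. A universal enveloping Hom-associative algebra of a Hom-Lie algebra $\mathfrak g$ is a Hom-associative algebra $\mathfrak U$ together with a morphism of Hom-Lie algebras $\phi:\mathfrak g\to(\mathfrak U,[\,,\,]_{\mathfrak U},\beta_{\mathfrak U})$ such that for any Hom-associative algebra $A$ (not necessarily involutive) and any morphism of Hom-Lie algebras $\xi:\mathfrak g\to(A,[\,,\,]_A,\beta_A)$ there exists a unique morphism of Hom-associative algebras $\hat\xi:\mathfrak U\to A$ with $\hat\xi\circ\phi=\xi$. The Hom-tensor algebra: $T^+_h(\mathfrak g):=\bigoplus_{n\ge1}\mathfrak g^{\otimes n}$ as a module; $\alpha_T(a_1\otimes\cdots\otimes a_n)=\beta_{\mathfrak g}(a_1)\otimes\cdots\otimes\beta_{\mathfrak g}(a_n)$; and $\odot$ is the bilinear operation defined on pure tensors $\mathfrak a\in\mathfrak g^{\otimes m}$, $\mathfrak b=b_1\otimes\cdots\otimes b_n\in\mathfrak g^{\otimes n}$ by induction on $n$: $\mathfrak a\odot\mathfrak b:=\mathfrak a\otimes\mathfrak b$ for $n=1$, and $\mathfrak a\odot\mathfrak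 b:=\big(\alpha_T(\mathfrak a)\odot(b_1\otimes\cdots\otimes b_k)\big)\otimes\alpha_T(b_{k+1})$ for $n=k+1$, $k\ge1$. With these operations $T^+_h(\mathfrak g)$ is an involutive Hom-associative algebra, and is the free one on the involutive Hom-module $(\mathfrak g,\beta_{\mathfrak g})$. *)

(* Defs.v *)
From HB Require Import structures.
From mathcomp Require Import all_boot all_algebra ring_quotient.
From mathcomp Require Import boolp.

Set Implicit Arguments.
Unset Strict Implicit.
Unset Printing Implicit Defensive.

Import GRing.Theory.
Local Open Scope ring_scope.
Local Open Scope quotient_scope.

(* The base ring is any commutative ring, possibly zero ([comPzRingType]).     *)
(* The library's [{bilinear _ -> _ -> _}] and free modules require a nonzero   *)
(* ring, and it has no tensor product of arbitrary modules; quotient modules,  *)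
(* direct sums and tensor products are therefore constructed here.             *)

Section Bilinear.
Variables (k : comPzRingType) (M N V : lmodType k).

Definition bilinear_map (f : M -> N -> V) : Prop :=
  (forall v, linear (f^~ v)) /\ (forall u, linear (f u)).

End Bilinear.

Section LinearPred.
Variables (k : pzRingType) (M V : lmodType k) (f : M -> V) (lf : linear f).

Definition linear_of : M -> V := let _ := lf in f.
HB.instance Definition _ := GRing.isLinear.Build k M V *:%R linear_of lf.

Lemma lin0 : f 0 = 0. Proof. exact: (linear0 linear_of). Qed.
Lemma linD u v : f (u + v) = f u + f v. Proof. exact: (linearD linear_of). Qed.
Lemma linB u v : f (u - v) = f u - f v. Proof. exact: (linearB linear_of). Qed.
Lemma linZ a u : f (a *: u) = a *: f u. Proof. exact: (scalable_linear lf). Qed.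

Lemma linear_comp (U : lmodType k) (g : V -> U) : linear g -> linear (g \o f).
Proof. by move=> lg a u v /=; rewrite lf lg. Qed.

End LinearPred.

Section QuotientModule.
Variables (k : pzRingType) (V : lmodType k) (W : submodClosed V).

(* [submodClosed] is stated for semimodules and does not carry closure under   *)
(* opposite, which the quotient of the underlying additive group requires.     *)
Definition zmod_pred : {pred V} := W.

Fact zmod_pred_closed : zmod_closed zmod_pred.
Proof. by apply: GRing.submod_closedB; apply: submodClosedP. Qed.

HB.instance Definition _ := GRing.isZmodClosed.Build V zmod_pred zmod_pred_closed.

Definition quotm : Type := Quotient.quot zmod_pred.
HB.instance Definition _ := GRing.Zmodule.on quotm.

Definition quot_map (v : V) : quotm := \pi_(Quotient.quot zmod_pred) v.
Definition quot_repr (x : quotm) : V := repr (x : Quotient.quot zmod_pred).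

Lemma quot_reprK : cancel quot_repr quot_map.
Proof. exact: reprK. Qed.

Lemma quot_map_eq u v : (quot_map u == quot_map v) = (u - v \in W).
Proof. exact: esym (Quotient.idealrBE zmod_pred u v). Qed.

Lemma quot_mapK v : quot_repr (quot_map v) - v \in W.
Proof. by rewrite -quot_map_eq quot_reprK. Qed.

Let quot_mapD u v : quot_map (u + v) = quot_map u + quot_map v.
Proof. exact: (raddfD (\pi_(Quotient.quot zmod_pred))). Qed.

Definition quot_scale (a : k) (x : quotm) : quotm := quot_map (a *: quot_repr x).

Let quot_scaleE a u : quot_scale a (quot_map u) = quot_map (a *: u).
Proof. by apply/eqP; rewrite quot_map_eq -scalerBr rpredZ // quot_mapK. Qed.

Fact quot_scalerA a b v : quot_scale a (quot_scale b v) = quot_scale (a * b) v.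
Proof. by rewrite -[v]quot_reprK !quot_scaleE scalerA. Qed.

Fact quot_scale1r : left_id 1 quot_scale.
Proof. by move=> v; rewrite -[v]quot_reprK quot_scaleE scale1r. Qed.

Fact quot_scalerDr : right_distributive quot_scale +%R.
Proof.
move=> a u v; rewrite -[u]quot_reprK -[v]quot_reprK -quot_mapD.
by rewrite !quot_scaleE scalerDr quot_mapD.
Qed.

Fact quot_scalerDl v : {morph quot_scale^~ v : a b / a + b}.
Proof.
by move=> a b; rewrite -[v]quot_reprK !quot_scaleE scalerDl quot_mapD.
Qed.

HB.instance Definition _ := GRing.Zmodule_isLmodule.Build k quotm
  quot_scalerA quot_scale1r quot_scalerDr quot_scalerDl.

Fact quot_map_linear : linear quot_map.
Proof. by move=> a u v; rewrite quot_mapD -quot_scaleE. Qed.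

HB.instance Definition _ :=
  GRing.isLinear.Build k V quotm *:%R quot_map quot_map_linear.

Section Lift.
Variables (U : lmodType k) (f : V -> U).

Definition quot_lift (x : quotm) : U := f (quot_repr x).

Hypotheses (lf : linear f) (fW : forall v, v \in W -> f v = 0).

Lemma quot_liftE v : quot_lift (quot_map v) = f v.
Proof. by apply/eqP; rewrite -subr_eq0 -(linB lf) fW // quot_mapK. Qed.

Fact quot_lift_linear : linear quot_lift.
Proof.
move=> a x y; rewrite -[x]quot_reprK -[y]quot_reprK.
by rewrite -quot_map_linear !quot_liftE lf.
Qed.

End Lift.

End QuotientModule.

Section Span.
Variables (k : pzRingType) (V : lmodType k) (S : V -> Prop).

Definition span : {pred V} := fun v =>
  `[< forall W : {pred V}, submod_closed W -> (forall s, S s -> s \in W) ->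
        v \in W >].

Fact span_closed : submod_closed span.
Proof.
split=> [|a u v /asboolP uS /asboolP vS]; apply/asboolP => W W_sub SW.
  by case: W_sub.
by case: (W_sub) => _; apply; [apply: uS | apply: vS].
Qed.

HB.instance Definition _ := GRing.isSubmodClosed.Build k V span
  (GRing.submod_closed_semi span_closed).

Lemma mem_span s : S s -> s \in span.
Proof. by move=> Ss; apply/asboolP => W _; apply. Qed.

Lemma span_ker (U : lmodType k) (f : V -> U) : linear f ->
  (forall s, S s -> f s = 0) -> forall v, v \in span -> f v = 0.
Proof.
move=> lf fS v /asboolP /(_ (fun x => f x == 0)) vS.
apply/eqP/vS => [|s /fS fs0]; last exact/eqP.
split=> [|a x y /eqP fx0 /eqP fy0]; first exact/eqP/(lin0 lf).
by apply/eqP; rewrite lf fx0 fy0 scaler0 addr0.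
Qed.

End Span.

Section DirectProduct.
Variables (k : pzRingType) (I : Type) (M : I -> lmodType k).

Definition dprod : Type := forall i, M i.
HB.instance Definition _ := Choice.on dprod.

Let add (x y : dprod) : dprod := fun i => x i + y i.
Let zero : dprod := fun=> 0.
Let opp (x : dprod) : dprod := fun i => - x i.
Let scale a (x : dprod) : dprod := fun i => a *: x i.

Let addA : associative add.
Proof. by move=> x y z; apply: functional_extensionality_dep => i; apply: addrA. Qed.
Let addC : commutative add.
Proof. by move=> x y; apply: functional_extensionality_dep => i; apply: addrC. Qed.
Let add0 : left_id zero add.
Proof. by move=> x; apply: functional_extensionality_dep => i; apply: add0r. Qed.
Let addN : left_inverse zero opp add.
Proof. by move=> x; apply: functional_extensionality_dep => i; apply: addNr. Qed.

HB.instance Definition _ := GRing.isZmodule.Build dprod addA addC add0 addN.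

Let scaleA a b v : scale a (scale b v) = scale (a * b) v.
Proof. by apply: functional_extensionality_dep => i; apply: scalerA. Qed.
Let scale1 : left_id 1 scale.
Proof. by move=> x; apply: functional_extensionality_dep => i; apply: scale1r. Qed.
Let scaleDr : right_distributive scale +%R.
Proof. by move=> a x y; apply: functional_extensionality_dep => i; apply: scalerDr. Qed.
Let scaleDl v : {morph scale^~ v : a b / a + b}.
Proof. by move=> a b; apply: functional_extensionality_dep => i; apply: scalerDl. Qed.

HB.instance Definition _ := GRing.Zmodule_isLmodule.Build k dprod
  scaleA scale1 scaleDr scaleDl.

End DirectProduct.

Section DirectSum.
Variables (k : pzRingType) (I : eqType) (M : I -> lmodType k).

Definition finite_support : {pred dprod M} := fun x =>
  `[< exists s : seq I, forall i, i \notin s -> x i = 0 >].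

Fact finite_support_closed : submod_closed finite_support.
Proof.
split; first by apply/asboolP; exists [::].
move=> a x y /asboolP [s sx] /asboolP [t ty]; apply/asboolP.
exists (s ++ t) => i; rewrite mem_cat negb_or => /andP[/sx xi /ty yi].
by rewrite [LHS]/GRing.add /= [X in X + _]/GRing.scale /= xi yi scaler0 addr0.
Qed.

HB.instance Definition _ := GRing.isSubmodClosed.Build k (dprod M)
  finite_support (GRing.submod_closed_semi finite_support_closed).

Record dsum : Type := DSum { dval : dprod M; _ : dval \in finite_support }.
HB.instance Definition _ := [isSub for dval].
HB.instance Definition _ := [Choice of dsum by <:].
HB.instance Definition _ := [SubChoice_isSubLmodule of dsum by <:].

Definition dcoef (x : dsum) : forall i, M i := val x.
Coercion dcoef : dsum >-> Funclass.

Lemma dsumP (x y : dsum) : (forall i, x i = y i) -> x = y.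
Proof. by move=> xy; apply/val_inj/functional_extensionality_dep. Qed.

Fact dsupp_ex (x : dsum) : exists s : seq I, forall i, i \notin s -> x i = 0.
Proof. exact: asboolW (valP x). Qed.

Definition dsupp (x : dsum) : seq I := undup (sval (cid (dsupp_ex x))).

Lemma dsupp_uniq x : uniq (dsupp x). Proof. exact: undup_uniq. Qed.

Lemma dsuppP x i : i \notin dsupp x -> x i = 0.
Proof. by rewrite mem_undup; case: cid => s /= /(_ i). Qed.

Lemma dcoef_linear a (x y : dsum) i : (a *: x + y) i = a *: x i + y i.
Proof. by []. Qed.

Fact din_subproof i (u : M i) :
  (dfwith (fun=> 0) u : dprod M) \in finite_support.
Proof.
apply/asboolP; exists [:: i] => j; rewrite inE eq_sym => ij.
by rewrite dfwith_out.
Qed.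

Definition din i (u : M i) : dsum := DSum (din_subproof u).

Lemma din_eq i (u : M i) : din u i = u.
Proof. exact: dfwith_in. Qed.

Lemma din_neq i j (u : M i) : i != j -> din u j = 0.
Proof. exact: dfwith_out. Qed.

Fact din_linear i : linear (@din i).
Proof.
move=> a u v; apply: dsumP => j; rewrite dcoef_linear.
by case: (eqVneq i j) => [<-|ij]; rewrite ?din_eq // !din_neq // scaler0 addr0.
Qed.

HB.instance Definition _ i :=
  GRing.isLinear.Build k (M i) dsum *:%R (@din i) (@din_linear i).

Section Lift.
Variables (V : lmodType k) (f : forall i, M i -> V).

(* The map with components [f]; it is linear when every [f i] is. *)
Definition dlift (x : dsum) : V := \sum_(i <- dsupp x) f (x i).

Hypothesis lf : forall i, linear (@f i).

Let f0 i : f (0 : M i) = 0.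
Proof. exact: (lin0 (@lf i)). Qed.

Lemma dlift_supp (x : dsum) (s : seq I) : uniq s -> (forall i, i \notin s -> x i = 0) ->
  dlift x = \sum_(i <- s) f (x i).
Proof.
move=> us xs; rewrite /dlift.
have E (t : seq I) : \sum_(i <- t) f (x i) = \sum_(i <- t | x i != 0) f (x i).
  rewrite [RHS]big_mkcond; apply: eq_bigr => i _.
  by case: eqP => // ->; rewrite f0.
rewrite E [RHS]E -big_filter -[RHS]big_filter; apply: perm_big.
apply: uniq_perm; rewrite ?filter_uniq ?dsupp_uniq // => i.
rewrite !mem_filter; case: (x i =P 0) => //= xi0.
case: (boolP (i \in dsupp x)) => [_|/dsuppP //].
by case: (boolP (i \in s)) => [|/xs].
Qed.

Fact dlift_linear : linear dlift.
Proof.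
move=> a x y; pose s := undup (dsupp x ++ dsupp y).
have us : uniq s := undup_uniq _.
have sx i : i \notin s -> x i = 0.
  by rewrite mem_undup mem_cat negb_or => /andP[/dsuppP].
have sy i : i \notin s -> y i = 0.
  by rewrite mem_undup mem_cat negb_or => /andP[_ /dsuppP].
rewrite (dlift_supp us sx) (dlift_supp us sy) (@dlift_supp (a *: x + y) s) //.
  rewrite scaler_sumr -big_split /=; apply: eq_bigr => i _.
  by rewrite dcoef_linear lf.
by move=> i si; rewrite dcoef_linear sx // sy // scaler0 addr0.
Qed.

Lemma dlift_din i (u : M i) : dlift (din u) = f u.
Proof.
rewrite (@dlift_supp _ [:: i]) //; first by rewrite big_seq1 din_eq.
by move=> j; rewrite inE eq_sym => /din_neq.
Qed.

End Lift.

Lemma dsum_sum (x : dsum) : x = \sum_(i <- dsupp x) din (x i).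
Proof.
apply: dsumP => j.
have -> : (\sum_(i <- dsupp x) din (x i)) j = \sum_(i <- dsupp x) din (x i) j.
  by elim/big_rec2: _ => [|i y z _ <-].
have [jx|jx] := boolP (j \in dsupp x).
  rewrite (bigD1_seq j) ?dsupp_uniq //= din_eq big1 ?addr0 // => i ij.
  by rewrite din_neq.
rewrite big_seq big1 ?dsuppP // => i ix; rewrite din_neq //.
by apply: contraNneq jx => <-.
Qed.

Lemma dsum_ind (P : dsum -> Prop) : P 0 -> (forall x y, P x -> P y -> P (x + y)) ->
  (forall i (u : M i), P (din u)) -> forall x, P x.
Proof.
by move=> P0 PD Pin x; rewrite [x]dsum_sum; elim/big_ind: _ => // i _; apply: Pin.
Qed.

End DirectSum.

Section Tensor.
Variables (k : comPzRingType) (M N : lmodType k).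

Definition free_pair : lmodType k := dsum (fun _ : M * N => k^o : lmodType k).

Definition free_gen (u : M) (v : N) : free_pair :=
  @din k _ (fun=> k^o) (u, v) (1 : k^o).

Definition tensor_rel (x : free_pair) : Prop :=
  (exists a u u' v,
     x = free_gen (a *: u + u') v - (a *: free_gen u v + free_gen u' v)) \/
  (exists a u v v',
     x = free_gen u (a *: v + v') - (a *: free_gen u v + free_gen u v')).

Definition tensor : Type := quotm (span tensor_rel).
HB.instance Definition _ := GRing.Lmodule.on tensor.

Definition tens (u : M) (v : N) : tensor :=
  quot_map (span tensor_rel) (free_gen u v).

Lemma tens_bilinear : bilinear_map tens.
Proof.
rewrite /tens; split=> [v a u u'|u a v v']; rewrite -linearP; apply/eqP;
  rewrite quot_map_eq; apply: mem_span; [left|right].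
  by exists a, u, u', v.
by exists a, u, v, v'.
Qed.

Section Lift.
Variables (V : lmodType k) (f : M -> N -> V).

(* The linear map out of the tensor product induced by [f]; meaningful when    *)
(* [f] is bilinear.                                                            *)
Definition tlift : tensor -> V :=
  quot_lift (dlift (fun (p : M * N) (c : k^o) => (c : k) *: f p.1 p.2)).

Hypothesis bf : bilinear_map f.

Let g (p : M * N) (c : k^o) : V := (c : k) *: f p.1 p.2.
Let lg p : linear (@g p).
Proof. by move=> a c d; rewrite /g scalerDl scalerA. Qed.
Let g_gen u v : dlift g (free_gen u v) = f u v.
Proof. by rewrite dlift_din // /g scale1r. Qed.
Let g_rel x : x \in span tensor_rel -> dlift g x = 0.
Proof.
have lG := dlift_linear lg; move: x; apply: (span_ker lG) => s.
case=> [[a [u [u' [v ->]]]]|[a [u [v [v' ->]]]]].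
  by rewrite (linB lG) lG !g_gen (proj1 bf) subrr.
by rewrite (linB lG) lG !g_gen (proj2 bf) subrr.
Qed.

Fact tlift_linear : linear tlift.
Proof. exact: quot_lift_linear (dlift_linear lg) g_rel. Qed.

Lemma tlift_tens u v : tlift (tens u v) = f u v.
Proof. by rewrite /tlift /tens (quot_liftE (dlift_linear lg) g_rel) g_gen. Qed.

End Lift.

Lemma tensor_ind (P : tensor -> Prop) : P 0 ->
  (forall x y, P x -> P y -> P (x + y)) -> (forall u v, P (tens u v)) ->
  forall x, P x.
Proof.
move=> P0 PD Pt x; rewrite -[x]quot_reprK; move: (quot_repr x) => {}x.
elim/dsum_ind: x => [|x y Px Py|[u v] c]; first by rewrite linear0.
  by rewrite linearD; apply: PD.
suff -> : @din k _ (fun=> k^o) (u, v) c = c *: free_gen u v.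
  rewrite linearZ -[X in P X]/(c *: tens u v).
  by rewrite -(linZ (proj1 tens_bilinear v)); apply: Pt.
rewrite /free_gen -(linZ (din_linear (M := fun=> k^o) (i := (u, v)))).
by congr din; apply: esym (mulr1 c).
Qed.

End Tensor.

(* [twist] is the structure operator of a Hom-module: alpha for an associative *)
(* algebra, beta for a Lie algebra.                                            *)
HB.mixin Record hasTwist (k : comPzRingType) M of GRing.Lmodule k M := {
  twist : {linear M -> M}
}.

#[short(type="homModType")]
HB.structure Definition HomModule (k : comPzRingType) :=
  {M of GRing.Lmodule k M & hasTwist k M}.

HB.mixin Record isInvolutive (k : comPzRingType) M of HomModule k M := {
  twistK : involutive (@twist k M)
}.

#[short(type="invHomModType")]
HB.structure Definition InvHomModule (k : comPzRingType) :=
  {M of HomModule k M & isInvolutive k M}.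

HB.mixin Record isHomAssociative (k : comPzRingType) A of HomModule k A := {
  hmul : A -> A -> A;
  hmul_bilinear : bilinear_map hmul;
  hmul_twist : forall x y : A, twist (hmul x y) = hmul (twist x) (twist y);
  hmulA : forall x y z : A, hmul (twist x) (hmul y z) = hmul (hmul x y) (twist z)
}.

#[short(type="homAssocType")]
HB.structure Definition HomAssoc (k : comPzRingType) :=
  {A of HomModule k A & isHomAssociative k A}.

HB.mixin Record isHomLie (k : comPzRingType) L of HomModule k L := {
  hbracket : L -> L -> L;
  hbracket_bilinear : bilinear_map hbracket;
  hbracket_anti : forall x y : L, hbracket x y = - hbracket y x;
  hbracket_jacobi : forall x y z : L,
    hbracket (twist x) (hbracket y z) + hbracket (twist y) (hbracket z x)
      + hbracket (twist z) (hbracket x y) = 0;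
  hbracket_twist : forall x y : L,
    twist (hbracket x y) = hbracket (twist x) (twist y)
}.

#[short(type="homLieType")]
HB.structure Definition HomLie (k : comPzRingType) :=
  {L of HomModule k L & isHomLie k L}.

#[short(type="invHomLieType")]
HB.structure Definition InvHomLie (k : comPzRingType) :=
  {L of HomLie k L & InvHomModule k L}.

Definition hom_assoc_morphism (k : comPzRingType) (A B : homAssocType k)
    (f : A -> B) : Prop :=
  [/\ linear f, forall x y, f (hmul x y) = hmul (f x) (f y)
    & forall x, f (twist x) = twist (f x)].

Definition hom_lie_morphism (k : comPzRingType) (L K : homLieType k)
    (f : L -> K) : Prop :=
  [/\ linear f, forall x y, f (hbracket x y) = hbracket (f x) (f y)
    & forall x, f (twist x) = twist (f x)].

Definition hom_assoc_isomorphism (k : comPzRingType) (A B : homAssocType k)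
    (f : A -> B) : Prop :=
  hom_assoc_morphism f /\
  exists g : B -> A, [/\ hom_assoc_morphism g, cancel f g & cancel g f].

Section Commutator.
Variables (k : comPzRingType) (A : homAssocType k).

Definition lie_of : Type := A.
HB.instance Definition _ := HomModule.on lie_of.

Let comm (x y : lie_of) : lie_of := (hmul (x : A) (y : A) - hmul (y : A) (x : A))%R.

Let mulBl (x y z : A) : hmul (x - y) z = hmul x z - hmul y z.
Proof. exact: (linB (proj1 (hmul_bilinear (s := A)) z)). Qed.

Let mulBr (x y z : A) : hmul x (y - z) = hmul x y - hmul x z.
Proof. exact: (linB (proj2 (hmul_bilinear (s := A)) x)). Qed.

Let comm_bilinear : bilinear_map comm.
Proof.
rewrite /comm; split=> x a y z /=;
  rewrite (proj1 (hmul_bilinear (s := A))) (proj2 (hmul_bilinear (s := A)));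
  by rewrite scalerBr opprD addrACA.
Qed.

Let comm_anti x y : comm x y = - comm y x.
Proof. by rewrite /comm opprB. Qed.

Let comm_jacobi x y z : comm (twist x) (comm y z) + comm (twist y) (comm z x)
  + comm (twist z) (comm x y) = 0.
Proof.
have E (a b c d : A) : a - b - (c - d) = (a + d) - (b + c).
  by rewrite opprB addrACA -opprD.
have F (p q r : A) : p - q + (q - r) = p - r by rewrite addrA subrK.
rewrite /comm !mulBl !mulBr !hmulA !E.
set a := hmul (hmul x y) _; set b := hmul (hmul x z) _.
set c := hmul (hmul y z) _; set d := hmul (hmul z y) _.
set e := hmul (hmul y x) _; set f := hmul (hmul z x) _.
by rewrite (addrC c b) (addrC f e) (addrC d a) !F subrr.
Qed.

Let comm_twist x y : twist (comm x y) = comm (twist x) (twist y).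
Proof. by rewrite /comm linearB /= !hmul_twist. Qed.

HB.instance Definition _ :=
  isHomLie.Build k lie_of comm_bilinear comm_anti comm_jacobi comm_twist.

Lemma hbracket_lie_of (x y : A) :
  hbracket (x : lie_of) y = hmul x y - hmul y x :> A.
Proof. by []. Qed.

End Commutator.

Definition hom_ideal_closed (k : comPzRingType) (A : homAssocType k)
    (I : {pred A}) : Prop :=
  [/\ submod_closed I, {in I, forall x y, hmul x y \in I},
      {in I, forall x y, hmul y x \in I} & {in I, forall x, twist x \in I}].

Record homIdeal (k : comPzRingType) (A : homAssocType k) := HomIdeal {
  hom_ideal_pred :> {pred A};
  hom_idealP : hom_ideal_closed hom_ideal_pred
}.

Section HomQuotient.
Variables (k : comPzRingType) (A : homAssocType k) (I : homIdeal A).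

Let I_submod : submod_closed (I : {pred A}).
Proof. by case: (hom_idealP I). Qed.

HB.instance Definition _ := GRing.isSubmodClosed.Build k A (hom_ideal_pred I)
  (GRing.submod_closed_semi I_submod).

Definition hquot : Type := quotm (hom_ideal_pred I).
HB.instance Definition _ := GRing.Lmodule.on hquot.

Definition hquot_map (x : A) : hquot := quot_map (hom_ideal_pred I) x.

Let hquot_repr (x : hquot) : A := quot_repr x.

Let reprK : cancel hquot_repr hquot_map.
Proof. exact: quot_reprK. Qed.

Lemma hquot_map_linear : linear hquot_map.
Proof. exact: quot_map_linear. Qed.

Lemma hquot_map_eq x y : (hquot_map x == hquot_map y) = (x - y \in I).
Proof. exact: quot_map_eq. Qed.

Let mapK x : hquot_repr (hquot_map x) - x \in I.
Proof. by rewrite -hquot_map_eq reprK. Qed.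

Definition hquot_mul (x y : hquot) : hquot :=
  hquot_map (hmul (hquot_repr x) (hquot_repr y)).

Definition hquot_twist (x : hquot) : hquot := hquot_map (twist (hquot_repr x)).

Lemma hquot_mulE x y : hquot_mul (hquot_map x) (hquot_map y) = hquot_map (hmul x y).
Proof.
have [_ Il Ir _] := hom_idealP I; apply/eqP; rewrite hquot_map_eq.
set x' := hquot_repr _; set y' := hquot_repr _.
have -> : hmul x' y' - hmul x y = hmul (x' - x) y' + hmul x (y' - y).
  rewrite (linB (proj1 (hmul_bilinear (s := A)) _)).
  by rewrite (linB (proj2 (hmul_bilinear (s := A)) _)) addrA subrK.
by apply: rpredD; [apply: Il | apply: Ir]; apply: mapK.
Qed.

Lemma hquot_twistE x : hquot_twist (hquot_map x) = hquot_map (twist x).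
Proof.
have [_ _ _ It] := hom_idealP I; apply/eqP.
by rewrite hquot_map_eq -linearB; apply/It/mapK.
Qed.

Fact hquot_twist_linear : linear hquot_twist.
Proof.
move=> a x y; rewrite -[x]reprK -[y]reprK -hquot_map_linear !hquot_twistE.
by rewrite linearP hquot_map_linear.
Qed.

HB.instance Definition _ :=
  GRing.isLinear.Build k hquot hquot *:%R hquot_twist hquot_twist_linear.
HB.instance Definition _ := hasTwist.Build k hquot hquot_twist.

Fact hquot_mul_bilinear : bilinear_map hquot_mul.
Proof.
split=> x a y z; rewrite -[x]reprK -[y]reprK -[z]reprK -hquot_map_linear.
  by rewrite !hquot_mulE (proj1 (hmul_bilinear (s := A))) hquot_map_linear.
by rewrite !hquot_mulE (proj2 (hmul_bilinear (s := A))) hquot_map_linear.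
Qed.

Fact hquot_mul_twist (x y : hquot) :
  twist (hquot_mul x y) = hquot_mul (twist x) (twist y).
Proof.
rewrite /twist /= -[x]reprK -[y]reprK.
by rewrite !(hquot_mulE, hquot_twistE) hmul_twist.
Qed.

Fact hquot_mulA (x y z : hquot) :
  hquot_mul (twist x) (hquot_mul y z) = hquot_mul (hquot_mul x y) (twist z).
Proof.
rewrite /twist /= -[x]reprK -[y]reprK -[z]reprK.
by rewrite !(hquot_mulE, hquot_twistE) hmulA.
Qed.

HB.instance Definition _ := isHomAssociative.Build k hquot
  hquot_mul_bilinear hquot_mul_twist hquot_mulA.

End HomQuotient.

Section HomIdealGen.
Variables (k : comPzRingType) (A : homAssocType k) (S : A -> Prop).

Definition hom_ideal_gen_pred : {pred A} := fun x =>
  `[< forall I : homIdeal A, (forall s, S s -> s \in I) -> x \in I >].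

Fact hom_ideal_gen_closed : hom_ideal_closed hom_ideal_gen_pred.
Proof.
split.
- split=> [|a x y /asboolP Ix /asboolP Iy]; apply/asboolP => I SI;
    have [[I0 IL] _ _ _] := hom_idealP I => //.
  by apply: IL; [apply: Ix | apply: Iy].
- move=> x /asboolP Ix y; apply/asboolP => I SI.
  by have [_ + _ _] := hom_idealP I; apply; apply: Ix.
- move=> x /asboolP Ix y; apply/asboolP => I SI.
  by have [_ _ + _] := hom_idealP I; apply; apply: Ix.
- move=> x /asboolP Ix; apply/asboolP => I SI.
  by have [_ _ _] := hom_idealP I; apply; apply: Ix.
Qed.

Definition hom_ideal_gen : homIdeal A := HomIdeal hom_ideal_gen_closed.

End HomIdealGen.

Section TensorPower.
Variables (k : comPzRingType) (M : homModType k).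

(* [tpow n] is the tensor power with [n.+1] factors, so that [hom_tensor]      *)
(* below is the direct sum of the tensor powers with at least one factor.      *)
(* In [odot], [n.+1 + m] reduces by recursion on [n], so no transport along    *)
(* equalities of indices is needed.                                            *)
Fixpoint tpow (n : nat) : lmodType k :=
  if n is n'.+1 then tensor (tpow n') M else M.

(* On pure tensors: a_1 (x) .. (x) a_n |-> twist a_1 (x) .. (x) twist a_n. *)
Fixpoint tpow_twist (n : nat) : tpow n -> tpow n :=
  if n is n'.+1 return tpow n -> tpow n
  then tlift (fun (a : tpow n') (b : M) => tens (tpow_twist a) (twist b))
  else twist.

(* a . b = a (x) b for one factor b, and                                       *)
(* a . (b (x) c) = (alpha a . b) (x) alpha c.                                  *)
Fixpoint odot (m n : nat) : tpow m -> tpow n -> tpow (n.+1 + m) :=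
  if n is n'.+1 return tpow m -> tpow n -> tpow (n.+1 + m)
  then fun a => tlift (fun (b : tpow n') (c : M) =>
                         tens (odot (tpow_twist a) b) (twist c))
  else fun a b => tens a b.

Fact tpow_twist_linear n : linear (@tpow_twist n).
Proof.
elim: n => [|n IH] /=; first exact: linearP.
apply: tlift_linear; split=> [c|a] b u v; first by rewrite IH (proj1 (tens_bilinear _ _)).
by rewrite linearP (proj2 (tens_bilinear _ _)).
Qed.

Lemma tpow_twist_tens n (a : tpow n) (b : M) :
  tpow_twist (tens a b : tpow n.+1) = tens (tpow_twist a) (twist b).
Proof.
rewrite /= tlift_tens //; split=> [c|d] e u v.
  by rewrite tpow_twist_linear (proj1 (tens_bilinear _ _)).
by rewrite linearP (proj2 (tens_bilinear _ _)).
Qed.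

Let odot_aux m n (a : tpow m) : (forall a, linear (@odot m n a)) ->
  bilinear_map (fun (b : tpow n) (c : M) => tens (odot (tpow_twist a) b) (twist c)).
Proof.
move=> IH; split=> [c|b] e u v; first by rewrite IH (proj1 (tens_bilinear _ _)).
by rewrite linearP (proj2 (tens_bilinear _ _)).
Qed.

Fact odot_bilinear m n : bilinear_map (@odot m n).
Proof.
elim: n => [|n [IHl IHr]]; first by split; case: (tens_bilinear (tpow m) M).
split=> [b|a]; last exact/tlift_linear/odot_aux.
move=> e u v /=; elim/tensor_ind: b => [|x y Px Py|b c].
- by rewrite !(lin0 (tlift_linear (odot_aux _ IHr))) scaler0 addr0.
- rewrite !(linD (tlift_linear (odot_aux _ IHr))) Px Py scalerDr.
  by rewrite addrACA.
- rewrite !(tlift_tens (odot_aux _ IHr)) tpow_twist_linear IHl.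
  by rewrite (proj1 (tens_bilinear _ _)).
Qed.

Lemma odot_tens m n (a : tpow m) (b : tpow n) (c : M) :
  odot a (tens b c : tpow n.+1) = tens (odot (tpow_twist a) b) (twist c).
Proof. by rewrite /= tlift_tens //; apply: odot_aux (proj2 (odot_bilinear m n)). Qed.

End TensorPower.

Section HomTensor.
Variables (k : comPzRingType) (M : homModType k).

Definition hom_tensor : Type := dsum (fun n => tpow M n).
HB.instance Definition _ := GRing.Lmodule.on hom_tensor.
Local Notation T := hom_tensor.

Definition hom_pure (n : nat) (u : tpow M n) : T := @din k _ (tpow M) n u.

Definition hom_tensor_twist : T -> T :=
  dlift (fun n (u : tpow M n) => hom_pure (tpow_twist u)).

Definition hom_tensor_mul (x y : T) : T :=
  dlift (fun m (u : tpow M m) =>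
    dlift (fun n (v : tpow M n) => hom_pure (odot u v)) y) x.

Definition hom_incl (u : M) : T := @hom_pure 0 u.

Definition hom_app (x : T) (c : M) : T :=
  dlift (fun n (u : tpow M n) => @hom_pure n.+1 (tens u c)) x.

Lemma hom_pure_linear n : linear (@hom_pure n).
Proof. exact: din_linear. Qed.

Lemma hom_incl_linear : linear hom_incl.
Proof. exact: (@hom_pure_linear 0). Qed.

Lemma hom_tensor_ind (P : T -> Prop) : P 0 ->
  (forall x y, P x -> P y -> P (x + y)) ->
  (forall n (u : tpow M n), P (hom_pure u)) -> forall x, P x.
Proof. exact: dsum_ind. Qed.

Fact hom_tensor_twist_linear : linear hom_tensor_twist.
Proof.
apply: dlift_linear => n a u v.
by rewrite tpow_twist_linear hom_pure_linear.
Qed.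

HB.instance Definition _ :=
  GRing.isLinear.Build k T T *:%R hom_tensor_twist hom_tensor_twist_linear.
HB.instance Definition _ := hasTwist.Build k T hom_tensor_twist.

Lemma hom_tensor_twistE n (u : tpow M n) :
  hom_tensor_twist (hom_pure u) = hom_pure (tpow_twist u).
Proof.
apply: dlift_din => m a v w.
by rewrite tpow_twist_linear hom_pure_linear.
Qed.

Let mul_r m (u : tpow M m) :
  linear (dlift (fun n (v : tpow M n) => hom_pure (odot u v))).
Proof.
apply: dlift_linear => n a v w.
by rewrite (proj2 (odot_bilinear _ _ _)) hom_pure_linear.
Qed.

Let mul_rE m n (u : tpow M m) (v : tpow M n) :
  dlift (fun n (v : tpow M n) => hom_pure (odot u v)) (hom_pure v) =
  hom_pure (odot u v).
Proof.
apply: (dlift_din (f := fun n (v : tpow M n) => hom_pure (odot u v))) => p a w z.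
by rewrite (proj2 (odot_bilinear _ _ _)) hom_pure_linear.
Qed.

Let mul_l (y : T) m : linear (fun u : tpow M m =>
  dlift (fun n (v : tpow M n) => hom_pure (odot u v)) y).
Proof.
move=> a u v; elim/hom_tensor_ind: y => [|x y Px Py|n w].
- by rewrite !(lin0 (mul_r _)) scaler0 addr0.
- by rewrite !(linD (mul_r _)) Px Py scalerDr addrACA.
- by rewrite !mul_rE (proj1 (odot_bilinear _ _ _)) hom_pure_linear.
Qed.

Fact hom_tensor_mul_bilinear : bilinear_map hom_tensor_mul.
Proof.
have lin_l y : linear (hom_tensor_mul^~ y) by exact: dlift_linear (mul_l y).
split=> // x a u v; elim/hom_tensor_ind: x => [|x y Px Py|n w].
- by rewrite !(lin0 (lin_l _)) scaler0 addr0.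
- by rewrite !(linD (lin_l _)) Px Py scalerDr addrACA.
- by rewrite /hom_tensor_mul !(dlift_din (mul_l _)) mul_r.
Qed.

Lemma hom_tensor_mulE m n (u : tpow M m) (v : tpow M n) :
  hom_tensor_mul (hom_pure u) (hom_pure v) = hom_pure (odot u v).
Proof. by rewrite /hom_tensor_mul (dlift_din (mul_l _)) mul_rE. Qed.

Let app_l c n : linear (fun u : tpow M n => @hom_pure n.+1 (tens u c)).
Proof. by move=> a u v; rewrite (proj1 (tens_bilinear _ _)) hom_pure_linear. Qed.

Lemma hom_app_pure n (u : tpow M n) c :
  hom_app (hom_pure u) c = @hom_pure n.+1 (tens u c).
Proof. by rewrite /hom_app (dlift_din (app_l c)). Qed.

Lemma hom_app_linear c : linear (hom_app^~ c).
Proof. exact: dlift_linear (app_l c). Qed.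

Lemma hom_tensor_gen (P : T -> Prop) : P 0 ->
  (forall x y, P x -> P y -> P (x + y)) -> (forall c, P (hom_incl c)) ->
  (forall x c, P x -> P (hom_app x c)) -> forall x, P x.
Proof.
move=> P0 PD Pi Pa; elim/hom_tensor_ind => //; elim=> [|n IH] u; first exact: Pi.
elim/tensor_ind: u => [|u v Pu Pv|u c]; first by rewrite (lin0 (@hom_pure_linear _)).
  by rewrite (linD (@hom_pure_linear _)); apply: PD.
by rewrite -hom_app_pure; apply: Pa.
Qed.

Let mul_0r x : hom_tensor_mul x 0 = 0.
Proof. exact: (lin0 (proj2 hom_tensor_mul_bilinear x)). Qed.
Let mul_0l x : hom_tensor_mul 0 x = 0.
Proof. exact: (lin0 (proj1 hom_tensor_mul_bilinear x)). Qed.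
Let mul_Dr x y z : hom_tensor_mul x (y + z) = hom_tensor_mul x y + hom_tensor_mul x z.
Proof. exact: (linD (proj2 hom_tensor_mul_bilinear x)). Qed.
Let mul_Dl x y z : hom_tensor_mul (y + z) x = hom_tensor_mul y x + hom_tensor_mul z x.
Proof. exact: (linD (proj1 hom_tensor_mul_bilinear x)). Qed.
Let tw_0 : hom_tensor_twist 0 = 0.
Proof. exact: (lin0 hom_tensor_twist_linear). Qed.
Let tw_D x y : hom_tensor_twist (x + y) = hom_tensor_twist x + hom_tensor_twist y.
Proof. exact: (linD hom_tensor_twist_linear). Qed.
Let app_0 c : hom_app 0 c = 0.
Proof. exact: (lin0 (hom_app_linear c)). Qed.
Let app_D c x y : hom_app (x + y) c = hom_app x c + hom_app y c.
Proof. exact: (linD (hom_app_linear c)). Qed.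

Lemma hom_tensor_mul_incl x c : hom_tensor_mul x (hom_incl c) = hom_app x c.
Proof.
elim/hom_tensor_ind: x => [|x y Px Py|n u]; first by rewrite mul_0l app_0.
  by rewrite mul_Dl app_D Px Py.
by rewrite hom_tensor_mulE hom_app_pure.
Qed.

Lemma hom_tensor_mul_app x y c : hom_tensor_mul x (hom_app y c) =
  hom_app (hom_tensor_mul (hom_tensor_twist x) y) (twist c).
Proof.
elim/hom_tensor_ind: y => [|y z Py Pz|n v]; first by rewrite app_0 !mul_0r app_0.
  by rewrite app_D !mul_Dr app_D Py Pz.
elim/hom_tensor_ind: x => [|x y Px Py|m u]; first by rewrite tw_0 !mul_0l app_0.
  by rewrite tw_D !mul_Dl app_D Px Py.
rewrite hom_app_pure hom_tensor_twistE !hom_tensor_mulE hom_app_pure.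
by rewrite odot_tens.
Qed.

Lemma hom_tensor_twist_incl c : hom_tensor_twist (hom_incl c) = hom_incl (twist c).
Proof. exact: hom_tensor_twistE. Qed.

Lemma hom_tensor_twist_app x c :
  hom_tensor_twist (hom_app x c) = hom_app (hom_tensor_twist x) (twist c).
Proof.
elim/hom_tensor_ind: x => [|x y Px Py|n u]; first by rewrite app_0 tw_0 app_0.
  by rewrite app_D !tw_D app_D Px Py.
by rewrite hom_tensor_twistE !hom_app_pure hom_tensor_twistE tpow_twist_tens.
Qed.

End HomTensor.

Section HomTensorAlgebra.
Variables (k : comPzRingType) (M : invHomModType k).
Local Notation T := (hom_tensor M).
Local Notation "x ** y" := (hom_tensor_mul x y) (at level 40, left associativity).

Fact hom_tensor_twistK : involutive (@hom_tensor_twist k M).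
Proof.
elim/hom_tensor_gen => [|x y Px Py|c|x c Px].
- by rewrite !(lin0 (@hom_tensor_twist_linear _ M)).
- by rewrite !(linD (@hom_tensor_twist_linear _ M)) Px Py.
- by rewrite !hom_tensor_twist_incl twistK.
- by rewrite !hom_tensor_twist_app Px twistK.
Qed.

HB.instance Definition _ := isInvolutive.Build k T hom_tensor_twistK.

Let tw_lin := @hom_tensor_twist_linear k M.
Let mul_lin x := proj2 (@hom_tensor_mul_bilinear k M) x.

Fact hom_tensor_mul_twist (x y : T) : twist (x ** y) = twist x ** twist y.
Proof.
rewrite /twist /=; elim/hom_tensor_gen: y x => [x|y z Py Pz x|c x|y c Py x].
- by rewrite (lin0 tw_lin) !(lin0 (mul_lin _)) (lin0 tw_lin).
- by rewrite (linD tw_lin) !(linD (mul_lin _)) (linD tw_lin) Py Pz.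
- by rewrite hom_tensor_twist_incl !hom_tensor_mul_incl hom_tensor_twist_app.
- by rewrite hom_tensor_twist_app !hom_tensor_mul_app hom_tensor_twist_app Py.
Qed.

Fact hom_tensor_mulA (x y z : T) : twist x ** (y ** z) = (x ** y) ** twist z.
Proof.
have twM u v := hom_tensor_mul_twist u v; rewrite /twist /= in twM *.
elim/hom_tensor_gen: z x y => [x y|z t Pz Pt x y|c x y|z c Pz x y].
- by rewrite (lin0 tw_lin) !(lin0 (mul_lin _)).
- by rewrite (linD tw_lin) !(linD (mul_lin _)) Pz Pt.
- rewrite hom_tensor_twist_incl !hom_tensor_mul_incl hom_tensor_mul_app.
  by rewrite hom_tensor_twistK.
- by rewrite hom_tensor_twist_app !hom_tensor_mul_app twM Pz.
Qed.

HB.instance Definition _ := isHomAssociative.Build k T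
  (@hom_tensor_mul_bilinear k M) hom_tensor_mul_twist hom_tensor_mulA.

End HomTensorAlgebra.

Definition universal_enveloping (k : comPzRingType) (g : homLieType k)
    (U : homAssocType k) (phi : g -> U) : Prop :=
  hom_lie_morphism (phi : g -> lie_of U) /\
  forall (A : homAssocType k) (xi : g -> A),
    hom_lie_morphism (xi : g -> lie_of A) ->
    exists! xi' : U -> A, hom_assoc_morphism xi' /\ xi' \o phi = xi.

Section Enveloping.
Variables (k : comPzRingType) (g : invHomLieType k).

Definition tens2 (x y : g) : hom_tensor g := @hom_pure k g 1 (tens x y).

Definition enveloping_rel (t : hom_tensor g) : Prop :=
  exists x y : g, t = tens2 x y - tens2 y x - hom_incl (hbracket x y).

Definition enveloping_ideal : homIdeal (hom_tensor g) := hom_ideal_gen enveloping_rel.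

Definition enveloping : homAssocType k := hquot enveloping_ideal.

Definition enveloping_incl : g -> enveloping :=
  hquot_map enveloping_ideal \o @hom_incl k g.

End Enveloping.

(* Main.v *)
Require Import Defs.
From mathcomp Require Import all_boot all_algebra.
From mathcomp Require Import boolp.

(** Both halves rest on universal properties.

    The target [A] of a Lie morphism [xi : g -> A] need not be involutive, but
    [xi] intertwines the operators, so the operator of [A] squares to the
    identity on the image of [xi]; being multiplicative, it squares to the
    identity on the Hom-subalgebra that [xi g] generates.  This is all that
    freeness of the Hom-tensor algebra asks of its target: a tensor
    a_1 (x) .. (x) a_n is the left-nested product (a_1 . a_2) .. . a_n, hence a
    Hom-module map [f : M -> A] has a single candidate extension
    ([hom_tensor_lift]), and the twist recursion defining the product of
    tensors turns into Hom-associativity in [A] once alpha^2 cancels on the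
    image ([hom_tensor_lift_mul]).

    When [f] is a Lie morphism, its extension kills the tensors
    x (x) y - y (x) x - [x, y].  The kernel of a morphism is a Hom-ideal, so it
    contains the one generated by these tensors ([hom_ideal_gen_ker]) and the
    extension descends to the quotient ([hquot_lift_morphism]).  Uniqueness on
    the quotient is uniqueness on the tensor algebra
    ([hom_tensor_morphism_unique]), since the projection is onto.

    Two universal objects are isomorphic because the composites of the two
    comparison morphisms solve the universal problem that the identities
    solve. *)

Set Implicit Arguments.
Unset Strict Implicit.
Unset Printing Implicit Defensive.

Import GRing.Theory.
Local Open Scope ring_scope.

(** * Morphisms of Hom-associative algebras *)

Section Morphisms.
Variable k : comPzRingType.

Lemma hom_assoc_morphism_id (A : homAssocType k) : hom_assoc_morphism (@id A).
Proof. by []. Qed.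

Lemma hom_assoc_morphism_comp (A B C : homAssocType k) (f : A -> B) (h : B -> C) :
  hom_assoc_morphism f -> hom_assoc_morphism h -> hom_assoc_morphism (h \o f).
Proof.
move=> [lf fM ft] [lh hM ht]; split; first exact: linear_comp.
- by move=> x y /=; rewrite fM hM.
- by move=> x /=; rewrite ft ht.
Qed.

Lemma hom_ideal_ker (A B : homAssocType k) (f : A -> B) : hom_assoc_morphism f ->
  hom_ideal_closed [pred x | f x == 0].
Proof.
move=> [lf fM ft]; split.
- split=> [|a x y]; rewrite !inE ?(lin0 lf) // => /eqP fx /eqP fy.
  by rewrite lf fx fy scaler0 addr0.
- move=> x /eqP fx y; rewrite inE fM fx.
  exact/eqP/(lin0 (proj1 (hmul_bilinear (s := B)) _)).
- move=> x /eqP fx y; rewrite inE fM fx.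
  exact/eqP/(lin0 (proj2 (hmul_bilinear (s := B)) _)).
- by move=> x /eqP fx; rewrite inE ft fx linear0.
Qed.

Lemma hom_ideal_gen_ker (A B : homAssocType k) (S : A -> Prop) (f : A -> B) :
  hom_assoc_morphism f -> (forall s, S s -> f s = 0) ->
  forall x, x \in (hom_ideal_gen S : {pred A}) -> f x = 0.
Proof.
move=> mf fS x /asboolP /(_ (HomIdeal (hom_ideal_ker mf))) kerP.
by apply/eqP/kerP => s /fS fs0; rewrite inE fs0.
Qed.

Lemma hom_ideal_gen_sub (A : homAssocType k) (S : A -> Prop) s :
  S s -> s \in (hom_ideal_gen S : {pred A}).
Proof. by move=> Ss; apply/asboolP => I; apply. Qed.

End Morphisms.

(** * Factoring morphisms through quotients *)

Section QuotientMorphisms.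
Variables (k : comPzRingType) (A : homAssocType k) (I : homIdeal A).

Lemma hquot_map_morphism : hom_assoc_morphism (hquot_map I : A -> hquot I).
Proof.
split=> [|x y|x]; first exact: hquot_map_linear.
- exact/esym/hquot_mulE.
- exact/esym/hquot_twistE.
Qed.

Lemma hquot_map_surj (x : hquot I) : exists y, x = hquot_map I y.
Proof. by exists (quot_repr x); rewrite /hquot_map quot_reprK. Qed.

Variables (B : homAssocType k) (f : A -> B).

Definition hquot_lift (x : hquot I) : B := quot_lift f x.

Hypotheses (mf : hom_assoc_morphism f)
           (fI : forall x, x \in (I : {pred A}) -> f x = 0).

Lemma hquot_liftE x : hquot_lift (hquot_map I x) = f x.
Proof. by have [lf _ _] := mf; apply: (quot_liftE lf fI). Qed.

Lemma hquot_lift_morphism : hom_assoc_morphism hquot_lift.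
Proof.
have [lf fM ft] := mf; have [_ qM qt] := hquot_map_morphism.
split=> [|x y|x]; first exact: (quot_lift_linear lf fI).
- have [x' ->] := hquot_map_surj x; have [y' ->] := hquot_map_surj y.
  by rewrite -qM !hquot_liftE.
- have [x' ->] := hquot_map_surj x.
  by rewrite -qt !hquot_liftE.
Qed.

End QuotientMorphisms.

(** * Freeness of the Hom-tensor algebra *)

Section HomTensorLift.
Variables (k : comPzRingType) (M : invHomModType k) (A : homAssocType k).
Variable f : M -> A.

Fixpoint tpow_lift (n : nat) : tpow M n -> A :=
  if n is n'.+1 return tpow M n -> A
  then tlift (fun (a : tpow M n') (c : M) => hmul (tpow_lift a) (f c))
  else f.

Definition hom_tensor_lift : hom_tensor M -> A := dlift tpow_lift.

Hypothesis lf : linear f.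

Let mulf_bilinear n : linear (@tpow_lift n) ->
  bilinear_map (fun (a : tpow M n) (c : M) => hmul (tpow_lift a) (f c)).
Proof.
have [ml mr] := hmul_bilinear (s := A).
by move=> IH; split=> [c|a] b u v; [rewrite IH ml | rewrite lf mr].
Qed.

Lemma tpow_lift_linear n : linear (@tpow_lift n).
Proof. by elim: n => [|n IH] //; apply/tlift_linear/mulf_bilinear. Qed.

Lemma hom_tensor_lift_linear : linear hom_tensor_lift.
Proof. exact/dlift_linear/tpow_lift_linear. Qed.

Lemma hom_tensor_lift_incl c : hom_tensor_lift (hom_incl c) = f c.
Proof. exact: (dlift_din tpow_lift_linear (i := 0%N)). Qed.

Lemma hom_tensor_lift_app x c :
  hom_tensor_lift (hom_app x c) = hmul (hom_tensor_lift x) (f c).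
Proof.
have lin0f := lin0 hom_tensor_lift_linear.
have [ml _] := hmul_bilinear (s := A).
elim/hom_tensor_ind: x => [|x y Px Py|n u].
- by rewrite (lin0 (hom_app_linear c)) lin0f (lin0 (ml _)).
- rewrite (linD (hom_app_linear c)) !(linD hom_tensor_lift_linear) Px Py.
  by rewrite (linD (ml _)).
rewrite hom_app_pure /hom_tensor_lift !(dlift_din tpow_lift_linear) /=.
exact: tlift_tens (mulf_bilinear (@tpow_lift_linear n)) _ _.
Qed.

Hypothesis ft : forall c, f (twist c) = twist (f c).

Lemma hom_tensor_lift_twist x :
  hom_tensor_lift (twist x) = twist (hom_tensor_lift x).
Proof.
have ll := hom_tensor_lift_linear; rewrite /twist /= -/twist.
elim/hom_tensor_gen: x => [|x y Px Py|c|x c Px].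
- by rewrite (lin0 (@hom_tensor_twist_linear _ M)) (lin0 ll) linear0.
- rewrite (linD (@hom_tensor_twist_linear _ M)) !(linD ll) Px Py.
  by rewrite linearD.
- by rewrite hom_tensor_twist_incl !hom_tensor_lift_incl ft.
- by rewrite hom_tensor_twist_app !hom_tensor_lift_app Px ft hmul_twist.
Qed.

(** The image of the lift inherits the involutivity of the tensor algebra:
    twist (twist (lift x)) = lift (twist (twist x)) = lift x.  This replaces
    involutivity of [A] in the step where Hom-associativity is applied. *)
Lemma hom_tensor_lift_mul x y :
  hom_tensor_lift (hmul x y) = hmul (hom_tensor_lift x) (hom_tensor_lift y).
Proof.
have ll := hom_tensor_lift_linear.
have mr := proj2 (hmul_bilinear (s := A)).
have mTr := proj2 (hmul_bilinear (s := hom_tensor M)).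
elim/hom_tensor_gen: y x => [x|y z Py Pz x|c x|y c Py x].
- by rewrite (lin0 (mTr _)) (lin0 ll) (lin0 (mr _)).
- by rewrite (linD (mTr _)) !(linD ll) (linD (mr _)) Py Pz.
- rewrite -[hmul x _]/(hom_tensor_mul x _) hom_tensor_mul_incl.
  by rewrite hom_tensor_lift_app hom_tensor_lift_incl.
- rewrite -[hmul x _]/(hom_tensor_mul x _) hom_tensor_mul_app.
  rewrite -[hom_tensor_mul _ y]/(hmul (twist x) y).
  rewrite !hom_tensor_lift_app Py ft -hmulA -hom_tensor_lift_twist.
  by rewrite twistK.
Qed.

Lemma hom_tensor_lift_morphism : hom_assoc_morphism hom_tensor_lift.
Proof.
split; first exact: hom_tensor_lift_linear.
- exact: hom_tensor_lift_mul.
- exact: hom_tensor_lift_twist.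
Qed.

End HomTensorLift.

(** Appending a factor to a tensor is multiplication on the right by a degree
    one element, so [M] generates the tensor algebra. *)
Lemma hom_tensor_morphism_unique (k : comPzRingType) (M : invHomModType k)
    (A : homAssocType k) (p q : hom_tensor M -> A) :
  hom_assoc_morphism p -> hom_assoc_morphism q ->
  p \o @hom_incl k M =1 q \o @hom_incl k M -> p =1 q.
Proof.
move=> [lp pM _] [lq qM _] pq; elim/hom_tensor_gen => [|x y Px Py|c|x c Px].
- by rewrite (lin0 lp) (lin0 lq).
- by rewrite (linD lp) (linD lq) Px Py.
- exact: pq.
- rewrite -hom_tensor_mul_incl -[hom_tensor_mul x _]/(hmul x _) pM qM Px.
  by congr hmul; apply: pq.
Qed.

(** * The universal enveloping Hom-associative algebra *)

Section EnvelopingUniversal.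
Variables (k : comPzRingType) (g : invHomLieType k).

Lemma tens2_hmul (x y : g) : tens2 x y = hmul (hom_incl x) (hom_incl y).
Proof. by rewrite -[hmul _ _]/(hom_tensor_mul _ _) hom_tensor_mulE. Qed.

Lemma enveloping_incl_morphism :
  hom_lie_morphism (@enveloping_incl k g : g -> lie_of (enveloping g)).
Proof.
have [lq qM qt] := hquot_map_morphism (enveloping_ideal g).
split.
- exact: (linear_comp (@hom_incl_linear k g) lq).
- move=> x y; rewrite hbracket_lie_of /enveloping_incl /= -!qM -(linB lq).
  apply/eqP; rewrite eq_sym hquot_map_eq -!tens2_hmul.
  by apply: hom_ideal_gen_sub; exists x, y.
- move=> x; rewrite /enveloping_incl /= -qt; congr hquot_map.
  exact/esym/hom_tensor_twist_incl.
Qed.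

Lemma hom_tensor_lift_enveloping_rel (A : homAssocType k) (xi : g -> A) :
  hom_lie_morphism (xi : g -> lie_of A) ->
  forall t, enveloping_rel t -> hom_tensor_lift xi t = 0.
Proof.
move=> [lxi xiM xit] _ [x [y ->]].
have [ll lM _] := hom_tensor_lift_morphism lxi xit.
rewrite !(linB ll) !tens2_hmul !lM !(hom_tensor_lift_incl lxi).
by rewrite xiM hbracket_lie_of subrr.
Qed.

Lemma enveloping_universal : universal_enveloping (@enveloping_incl k g).
Proof.
split=> [|A xi mxi]; first exact: enveloping_incl_morphism.
have [lxi _ xit] := mxi.
have ml := hom_tensor_lift_morphism lxi xit.
have lI := hom_ideal_gen_ker ml (hom_tensor_lift_enveloping_rel mxi).
exists (@hquot_lift _ _ (enveloping_ideal g) _ (hom_tensor_lift xi)).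
split; first split.
- exact: hquot_lift_morphism ml lI.
- by apply/funext => x /=; rewrite (hquot_liftE ml lI) hom_tensor_lift_incl.
- move=> h [mh hxi]; apply/funext => u.
  have [t ->] := hquot_map_surj u; rewrite (hquot_liftE ml lI).
  apply: (hom_tensor_morphism_unique ml
            (hom_assoc_morphism_comp (hquot_map_morphism _) mh)) => x /=.
  by rewrite hom_tensor_lift_incl // -hxi.
Qed.

End EnvelopingUniversal.

Section EnvelopingUnique.
Variables (k : comPzRingType) (g : homLieType k).

Lemma universal_enveloping_endo (U : homAssocType k) (phi : g -> U) (f : U -> U) :
  universal_enveloping phi -> hom_assoc_morphism f -> f \o phi = phi -> f =1 id.
Proof.
move=> [mphi univ] mf fphi x.
have [h [_ hU]] := univ _ _ mphi.
by rewrite -(hU f) // (hU id) //; split=> //; apply: hom_assoc_morphism_id.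
Qed.

Lemma universal_enveloping_iso (U U' : homAssocType k) (phi : g -> U)
    (phi' : g -> U') :
  universal_enveloping phi -> universal_enveloping phi' ->
  exists f : U -> U', hom_assoc_isomorphism f /\ f \o phi = phi'.
Proof.
move=> uU uU'; have [mphi univ] := uU; have [mphi' univ'] := uU'.
have [f [[mf fphi] _]] := univ _ _ mphi'.
have [h [[mh hphi'] _]] := univ' _ _ mphi.
exists f; split=> //; split=> //; exists h; split=> //.
- apply: (universal_enveloping_endo uU (hom_assoc_morphism_comp mf mh)).
  by rewrite -compA fphi.
- apply: (universal_enveloping_endo uU' (hom_assoc_morphism_comp mh mf)).
  by rewrite -compA hphi'.
Qed.

End EnvelopingUnique.

Theorem theorem3p4 (k : comPzRingType) (g : invHomLieType k) :
  universal_enveloping (@enveloping_incl k g) /\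
  forall (U U' : homAssocType k) (phi : g -> U) (phi' : g -> U'),
    universal_enveloping phi -> universal_enveloping phi' ->
    exists f : U -> U', hom_assoc_isomorphism f /\ f \o phi = phi'.
Proof.
split; first exact: enveloping_universal.
by move=> U U' phi phi'; apply: universal_enveloping_iso.
Qed.
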